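(* Let $n>1$ be a power of an odd prime, and let $\varphi$ denote Euler's totient function. Then there are integers $a_1,a_2,\ldots,a_{\varphi(n)}$ such that both $$\{a_1,\ldots,a_{\varphi(n)}\}\quad\text{and}\quad\{a_1-a_2,\ a_2-a_3,\ \ldots,\ a_{\varphi(n)-1}-a_{\varphi(n)},\ a_{\varphi(n)}-a_1\}$$ are reduced systems of residues modulo $n$.
   Context: A reduced system of residues modulo $n$ is a set of $\varphi(n)$ integers, each coprime to $n$, that are pairwise incongruent modulo $n$. *)

(* Defs.v *)
From HB Require Import structures.
From mathcomp Require Import all_boot all_order all_algebra finmap.
Set Implicit Arguments. Unset Strict Implicit. Unset Printing Implicit Defensive.

Definition reduced_residue_system (n : nat) (S : {fset int}) : Prop :=
  [/\ #|` S|%fset = totient n,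
      forall x : int, x \in S -> coprimez x n%:Z
    & forall x y : int, x \in S -> y \in S -> x <> y ->
        (x <> y %[mod n%:Z])%Z].

(* Main.v *)
Require Import Defs.
From HB Require Import structures.
From mathcomp Require Import all_boot all_order all_algebra finmap.
From mathcomp Require Import all_fingroup all_solvable.
Set Implicit Arguments. Unset Strict Implicit. Unset Printing Implicit Defensive.
Import Order.TTheory GRing.Theory Num.Theory.

(** The unit group modulo an odd prime power is cyclic, generated by some [u],
    and one takes [a_i = u ^ i]. The differences, read cyclically, are
    [u ^ i * (1 - u)] modulo [n], so it suffices that [1 - u] is invertible. As
    [-1 = u ^ m] for some [m], [1 - u] divides [1 - u ^ m = 2], a unit. *)

(** This unit group is isomorphic to the automorphism group of a cyclic group of order [p ^ k],
    which is cyclic for odd [p]. *)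
Lemma units_Zp_pfactor_cyclic p k :
  prime p -> odd p -> 0 < k -> cyclic (units_Zp (p ^ k)).
Proof.
move=> p_pr p_odd k_gt0.
have q_gt1 : 1 < p ^ k by rewrite -(exp1n k) ltn_exp2r ?prime_gt1.
pose G := [group of Zp (p ^ k)].
have oG : #|G| = p ^ k by rewrite card_Zp ?(ltnW q_gt1).
have cycG : cyclic G by apply/cyclicP; exists Zp1; rewrite -Zp_cycle /= /Zp q_gt1.
have pG : (p.-group G)%g by rewrite /pgroup oG pnatX pnat_id.
have ntG : G :!=: 1%g by rewrite -cardG_gt1 oG.
have cycA : cyclic (Aut G).
  have [m [_ [_ cycF _ _]]] := cyclic_pgroup_Aut_structure pG cycG ntG.
  (* If [G] has order [p], [Aut G] equals its largest normal subgroup of order prime to [p], which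
     is cyclic; for larger [G], oddness of [p] selects the cyclic case. *)
  case: ifP => [_ ->//|_ [t [_ _ _]]].
  by rewrite p_odd => -[[]].
have [x defG] := cyclicP cycG.
by have /isog_cyclic := Zp_unit_isog x; rewrite /= /order -defG oG => ->.
Qed.

Local Open Scope ring_scope.

Lemma coprimez_unit_Zp (n : nat) (x : int) : (1 < n)%N ->
  coprimez x n%:Z = ((x%:~R : 'Z_n) \is a GRing.unit).
Proof.
move=> n_gt1; rewrite coprimezE coprime_sym -unitZpE //.
by case: x => m //; rewrite NegzE mulrNz unitrN abszN.
Qed.

Lemma intr_Zp_eqmod (n : nat) (x y : int) : (1 < n)%N ->
  (x = y %[mod n%:Z])%Z -> x%:~R = y%:~R :> 'Z_n.
Proof.
move=> n_gt1 exy; have n0 : n%:R = 0 :> 'Z_n by exact: pchar_Zp.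
rewrite (divz_eq x n) (divz_eq y n) exy !rmorphD !rmorphM /=.
by rewrite -pmulrn n0 !mulr0.
Qed.

(** Injectivity in ['Z_n] yields both the cardinality and the pairwise incongruence, so the rest of
    the argument can take place in ['Z_n]. *)
Lemma reduced_residue_system_Zp (n : nat) (f : 'I_(totient n) -> int) :
    (1 < n)%N ->
    injective (fun i => (f i)%:~R : 'Z_n) ->
    (forall i, ((f i)%:~R : 'Z_n) \is a GRing.unit) ->
  reduced_residue_system n [fset f i | i in 'I_(totient n)]%fset.
Proof.
move=> n_gt1 f_inj f_unit; split=> [|x|x y].
- rewrite card_imfset /= -?enumT ?size_enum_ord //.
  by move=> i j eq_fij; apply: f_inj; rewrite /= eq_fij.
- by case/imfsetP=> i _ ->; rewrite coprimez_unit_Zp.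
case/imfsetP=> i _ -> /imfsetP[j _ ->] neq_f /(intr_Zp_eqmod n_gt1)/f_inj eq_ij.
by case: neq_f; rewrite eq_ij.
Qed.

Lemma unit_1B_generator (n : nat) (u : {unit 'Z_n}) :
    (1 < n)%N -> odd n -> units_Zp n = <[u]>%g ->
  1 - val u \is a GRing.unit.
Proof.
move=> n_gt1 n_odd def_u.
have unitN1 : (-1 : 'Z_n) \is a GRing.unit by rewrite unitrN1.
have /cycleP[m um] : FinRing.Unit unitN1 \in <[u]>%g by rewrite -def_u inE.
(* The geometric sum telescopes to [1 - u ^ m], where [u ^ m = -1]. *)
have dvd2 : (1 - val u) * \sum_(i < m) val u ^+ i = 2%:R.
  rewrite -opprB mulNr -subrX1 -FinRing.val_unitX -um /=.
  by rewrite opprB opprK.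
have : (2%:R : 'Z_n) \is a GRing.unit by rewrite unitZpE // coprime_sym coprime2n.
by rewrite -dvd2 unitrM => /andP[].
Qed.

Local Close Scope ring_scope.

(* [ordS] is the cyclic successor on ['I_m], so the last difference is
   [a_(phi(n)) - a_1]. *)
Theorem theorem1p5 (n : nat) (n_gt1 : 1 < n)
  (n_pow : exists p k : nat, [/\ prime p, odd p & n = p ^ k]) :
  exists a : 'I_(totient n) -> int,
    reduced_residue_system n [fset a i | i in 'I_(totient n)]%fset /\
    reduced_residue_system n
      [fset (a i - a (ordS i))%R | i in 'I_(totient n)]%fset.
Proof.
have [p [k [p_pr p_odd def_n]]] := n_pow.
have k_gt0 : 0 < k by case: k def_n n_gt1 => // ->.
have n_odd : odd n by rewrite def_n oddX p_odd orbT.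
have /cyclicP[u def_u] : cyclic (units_Zp n).
  by rewrite def_n units_Zp_pfactor_cyclic.
have ord_u : #[u]%g = totient n.
  by rewrite /order -def_u card_units_Zp // ltnW.
have unitX i : (val u ^+ i)%R \is a GRing.unit by rewrite unitrX ?(valP u).
have powu_inj : injective (fun i : 'I_(totient n) => (val u ^+ i)%R).
  move=> i j /=; rewrite -!FinRing.val_unitX => /val_inj/eqP.
  by rewrite eq_expg_ord ?ord_u // => /eqP.
have unit_1Bu := unit_1B_generator n_gt1 n_odd def_u.
(* The integer [a i] is the representative of [u ^ i] in [[0, n)]. *)
pose a (i : 'I_(totient n)) : int := Posz (val u ^+ i)%R.
have aE i : ((a i)%:~R = val u ^+ i :> 'Z_n)%R by rewrite /a -pmulrn natr_Zp.
have dE i : ((a i - a (ordS i))%:~R = val u ^+ i * (1 - val u) :> 'Z_n)%R.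
  (* [ordS i] is [i.+1] modulo [totient n], the order of [u], so its power is [u ^ i.+1] even when
     the index wraps around. *)
  rewrite rmorphB /= !aE -!FinRing.val_unitX /= -[X in (_ %% X)%N]ord_u expg_mod_order.
  by rewrite !FinRing.val_unitX mulrBr mulr1 exprSr.
exists a; split; apply: reduced_residue_system_Zp => // [i j|i].
- by rewrite !aE => /powu_inj.
- by rewrite aE.
- by rewrite !dE => /(mulIr unit_1Bu)/powu_inj.
- by rewrite dE unitrM unitX.
Qed.
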